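(* Let $m,n\in\mathbb N$ be standard, let $\mathcal A,\mathcal B,\mathcal C\in\mathcal M_{m,n}(\mathbb E)$, and let $\mathcal O\in\mathcal M_{m,n}(\mathbb E)$ be neutricial. Then: (1) $\mathcal A+(\mathcal B+\mathcal C)=(\mathcal A+\mathcal B)+\mathcal C$; (2) $\mathcal A+\mathcal B=\mathcal B+\mathcal A$; (3) $\mathcal A+\mathcal O=\mathcal A$ if and only if $\mathcal O_{ij}\subseteq(N(\mathcal A))_{ij}$ for all $1\le i\le m$, $1\le j\le n$; (4) $\mathcal A+(-\mathcal A)=N(\mathcal A)$. As a consequence, $\mathcal M_{m,n}(\mathbb E)$ is a commutative regular semigroup for addition.
   Context: We work in nonstandard analysis with external sets (the theory HST of Kanovei and Reeken, extending a bounded form of Nelson's IST), so $\mathbb R$ contains nonstandard numbers. A neutrix is a convex additive subgroup of $\mathbb R$ (possibly an external set). An external number is a set $\alpha=a+A=\{a+x: x\in A\}$ with $a\in\mathbb R$ and $A=N(\alpha)$ a neutrix (its neutrix part); $\mathbb E$ is the class of external numbers. Addition and opposite are Minkowski operations: $(a+A)+(b+B)=(a+b)+(A+B)$, $-(a+A)=-a+A$. $\mathcal M_{m,n}(\mathbb E)$ is the class of $m\times n$ matrices over $\mathbb E$ with entrywise addition and opposite. A matrix is neutricial if all its entries are neutrices. For $\mathcal A=(a_{ij}+A_{ij})$, $N(\mathcal A)=(A_{ij})$ is the associated neutricial matrix. A semigroup (written additively) is regular if for each $x$ there is $y$ with $x+y+x=x$. *)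

(* Defs.v *)
From HB Require Import structures.
From mathcomp Require Import all_boot all_order all_algebra.
From mathcomp Require Import all_classical all_reals all_analysis.

Set Implicit Arguments.
Unset Strict Implicit.
Unset Printing Implicit Defensive.

Import Order.TTheory GRing.Theory Num.Theory.

Local Open Scope classical_set_scope.
Local Open Scope ring_scope.

(** The ambient theory is rendered as follows.  A realType [R] is the field of
    standard reals, [S : nonstandard_reals R] is the field of all reals of the
    nonstandard theory, and Rocq's own types play the role of the external
    universe: [set S] contains every subset of [S], internal or external, and
    [nat] is the set of standard natural numbers. *)

Section Formulas.
Variable R : Type.

(** First-order formulas in the language having a symbol for every relation, of
    any arity, on [R].  Variables are natural numbers; [Rel P v] applies [P] to
    the variables listed by [v]. *)
Inductive formula :=
| Rel k of set ('I_k -> R) & ('I_k -> nat)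
| Not of formula
| And of formula & formula
| Exists of nat & formula.

Definition upd (D : Type) (e : nat -> D) (i : nat) (x : D) : nat -> D :=
  fun j => if j == i then x else e j.

Fixpoint holds (D : Type) (interp : forall k, set ('I_k -> R) -> set ('I_k -> D))
    (e : nat -> D) (phi : formula) : Prop :=
  match phi with
  | Rel _ P v => interp _ P (e \o v)
  | Not psi => ~ holds interp e psi
  | And psi chi => holds interp e psi /\ holds interp e chi
  | Exists i psi => exists x, holds interp (upd e i x) psi
  end.

End Formulas.

(** Standardization needs no axiom: [star] is defined on all subsets of [R]. *)
Record nonstandard_reals (R : realType) := NonstandardReals {
  nsreal :> realFieldType;
  std : R -> nsreal;
  star : forall k, set ('I_k -> R) -> set ('I_k -> nsreal);
  star_add : star [set v : 'I_3 -> R | v 0 + v 1 = v 2] =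
             [set v | v 0 + v 1 = v 2];
  star_mul : star [set v : 'I_3 -> R | v 0 * v 1 = v 2] =
             [set v | v 0 * v 1 = v 2];
  star_le : star [set v : 'I_2 -> R | v 0 <= v 1] = [set v | v 0 <= v 1];
  transfer : forall (phi : formula R) (e : nat -> R),
    holds (fun _ P => P) e phi <-> holds star (std \o e) phi;
  (* [phi] with the assignment [e] is an internal relation between the
     variables 0 and 1, the values of [e] being its internal parameters *)
  idealization : forall (phi : formula R) (e : nat -> nsreal),
    (forall s : seq R, exists y, forall x, x \in s ->
       holds star (upd (upd e 0 (std x)) 1 y) phi) <->
    (exists y, forall x : R, holds star (upd (upd e 0 (std x)) 1 y) phi)
}.

Section ExternalNumbers.
Variables (R : realType) (S : nonstandard_reals R).

Definition neutrix (A : set S) : Prop :=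
  [/\ A 0, forall x y, A x -> A y -> A (x + y), forall x, A x -> A (- x)
    & is_interval A].

Definition decomposition (alpha : set S) (a : S) (A : set S) : Prop :=
  neutrix A /\ alpha = [set a + x | x in A].

Record external := External {
  ext_set :> set S;
  ext_neutrix : exists A a, decomposition ext_set a A
}.

Lemma ext_add_subproof (alpha beta : external) :
  exists A a, decomposition [set x + y | x in alpha & y in beta] a A.
Proof.
case: alpha => sA [A [a [[A0 AD AN Ai] EA]]].
case: beta => sB [B [b [[B0 BD BN Bi] EB]]]; rewrite /= {}EA {}EB.
exists [set x + y | x in A & y in B], (a + b); split; [split|].
- by exists 0 => //; exists 0 => //; rewrite addr0.
- move=> _ _ [x Ax [y By <-]] [x' Ax' [y' By' <-]].
  by exists (x + x'); [exact: AD | exists (y + y'); [exact: BD | rewrite addrACA]].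
- move=> _ [x Ax [y By <-]].
  by exists (- x); [exact: AN | exists (- y); [exact: BN | rewrite opprD]].
- move=> _ _ [x Ax [y By <-]] [x' Ax' [y' By' <-]] z /andP[le1 le2].
  have [zx|xz] := leP z (x + y').
  + exists x => //; exists (z - x); last by rewrite addrC subrK.
    by apply: (Bi y y') => //; rewrite lerBrDl lerBlDl le1 zx.
  + exists (z - y'); last by exists y' => //; rewrite subrK.
    by apply: (Ai x x') => //; rewrite lerBrDr lerBlDr (ltW xz) le2.
- apply/seteqP; split.
  + move=> _ [_ [x Ax <-] [_ [y By <-] <-]].
    by exists (x + y); [exists x => //; exists y | rewrite addrACA].
  + move=> _ [_ [x Ax [y By <-]] <-].
    exists (a + x); first by exists x.
    by exists (b + y); [exists y | rewrite addrACA].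
Qed.

Definition ext_add (alpha beta : external) : external :=
  External (ext_add_subproof alpha beta).

Lemma ext_opp_subproof (alpha : external) :
  exists A a, decomposition [set - x | x in alpha] a A.
Proof.
case: alpha => sA [A [a [nA EA]]]; rewrite /= {}EA; exists A, (- a); split=> //.
case: nA => _ _ AN _; apply/seteqP; split.
- by move=> _ [_ [x Ax <-] <-]; exists (- x); [exact: AN | rewrite opprD].
- move=> _ [x Ax <-]; exists (a - x); first by exists (- x) => //; exact: AN.
  by rewrite opprB addrC.
Qed.

Definition ext_opp (alpha : external) : external :=
  External (ext_opp_subproof alpha).

Definition neutrix_set (alpha : external) : set S :=
  projT1 (cid (ext_neutrix alpha)).

Lemma neutrix_set_subproof (alpha : external) :
  exists A a, decomposition (neutrix_set alpha) a A.
Proof.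
rewrite /neutrix_set; case: cid => /= A [_ [nA _]].
exists A, 0; split=> //; apply/seteqP; split=> [x Ax|_ [x Ax <-]].
  by exists x => //; rewrite add0r.
by rewrite add0r.
Qed.

Definition ext_N (alpha : external) : external :=
  External (neutrix_set_subproof alpha).

(** The choice made by [neutrix_set] is the only possible one. *)
Lemma ext_N_eq (alpha : external) (a : S) (A : set S) :
  decomposition alpha a A -> ext_N alpha = A :> set S.
Proof.
have sub b B c C : decomposition alpha b B -> decomposition alpha c C ->
    B `<=` C.
  move=> [[B0 _ _ _] Bb] [[_ CD CN _] Cc] x Bx.
  have : [set b + x | x in B] (b + x) by exists x.
  have : [set b + x | x in B] b by exists 0; rewrite ?addr0.
  rewrite -Bb Cc => -[y Cy bE] [z Cz xE].
  suff -> : x = z - y by apply: CD => //; exact: CN.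
  by apply: (addrI b); rewrite -xE -bE addrACA subrr addr0.
move=> dA; rewrite /= /neutrix_set; case: cid => /= B [b dB].
by apply/seteqP; split; [exact: sub dB dA | exact: sub dA dB].
Qed.

Section Matrices.
Variables m n : nat.
Implicit Types A B : 'M[external]_(m, n).

Definition mx_add A B : 'M[external]_(m, n) := map2_mx ext_add A B.
Definition mx_opp A : 'M[external]_(m, n) := map_mx ext_opp A.
Definition mx_N A : 'M[external]_(m, n) := map_mx ext_N A.
Definition neutricial A : Prop := forall i j, neutrix (A i j).

End Matrices.

End ExternalNumbers.

Definition commutative_regular_semigroup (T : Type) (op : T -> T -> T) : Prop :=
  [/\ associative op, commutative op
    & forall x, exists y, op (op x y) x = x].

(* Main.v *)
Require Import Defs.
From HB Require Import structures.
From mathcomp Require Import all_boot all_order all_algebra.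
From mathcomp Require Import all_classical all_reals all_analysis.

(** Matrix addition is entrywise, so everything reduces to external numbers,
    that is, to cosets [a + A] of neutrices.  Minkowski addition inherits
    associativity and commutativity from the addition of [S].  A coset [a + A]
    absorbs a neutrix [B] exactly when [B] is contained in the stabilizer of
    the coset, which is [A] itself ([ext_add_absorb]); and
    [(a + A) - (a + A) = A - A = A] ([ext_addN]).  Regularity combines the two:
    [- alpha] is a pseudo-inverse of [alpha], since
    [alpha + (- alpha) + alpha = N(alpha) + alpha = alpha]
    ([ext_addNK]). *)

Local Open Scope classical_set_scope.

Section ExternalAddition.
Import GRing.Theory.
Local Open Scope ring_scope.
Variables (R : realType) (S : nonstandard_reals R).
Implicit Types alpha beta gamma : external S.

(** The second field of [external] is a proposition, so proof irrelevance makes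
    external numbers extensional. *)
Lemma external_inj alpha beta : alpha = beta :> set S -> alpha = beta.
Proof.
case: alpha beta => [sA pA] [sB pB] /= sAB.
by case: _ / sAB pB => pB; congr External; exact: Prop_irrelevance.
Qed.

Lemma ext_addA : associative (@ext_add R S).
Proof.
move=> alpha beta gamma; apply: external_inj; apply/seteqP; split=> /=.
- move=> _ [x ax [_ [y by_ [z cz <-]] <-]].
  by exists (x + y); [exists x => //; exists y | exists z; rewrite ?addrA].
- move=> _ [_ [x ax [y by_ <-]] [z cz <-]].
  by exists x => //; exists (y + z); [exists y => //; exists z | rewrite addrA].
Qed.

Lemma ext_addC : commutative (@ext_add R S).
Proof.
move=> alpha beta; apply: external_inj; apply/seteqP; split=> /=.
- by move=> _ [x ax [y by_ <-]]; exists y => //; exists x; rewrite // addrC.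
- by move=> _ [x ax [y by_ <-]]; exists y => //; exists x; rewrite // addrC.
Qed.

(** Since the neutrix part is determined by the set, the existentially quantified
    neutrix can be traded for [ext_N alpha]; only the representative is a choice. *)
Lemma ext_decomposition alpha : exists a, decomposition alpha a (ext_N alpha).
Proof.
case: (ext_neutrix alpha) => A [a dA].
by exists a; rewrite (ext_N_eq dA).
Qed.

Lemma ext_N_neutrix alpha : neutrix (ext_N alpha).
Proof. by have [a []] := ext_decomposition alpha. Qed.

(** For the direct implication, a point [x] of [beta] moves the representative
    [a] to a point [a + x] of [alpha], and [x] is the difference of the two; for
    the converse, closure of [ext_N alpha] under addition keeps the sum inside
    [alpha], and adding [0], a point of [beta], reaches all of it. *)
Lemma ext_add_absorb alpha beta : neutrix beta ->
  ext_add alpha beta = alpha <-> beta `<=` ext_N alpha.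
Proof.
move=> [b0 _ _ _]; have [a [[N0 ND _ _] alphaE]] := ext_decomposition alpha.
split=> [ab x bx|bN].
- have : (ext_add alpha beta : set S) (a + x).
    by exists a; [rewrite alphaE; exists 0; rewrite ?addr0 | exists x].
  by rewrite ab alphaE => -[y Ny /addrI <-].
- apply: external_inj; apply/seteqP; split=> [_ [x ax [y /bN Ny <-]]|x ax] /=.
    move: ax; rewrite alphaE => -[z Nz <-].
    by exists (z + y); [exact: ND | rewrite addrA].
  by exists x => //; exists 0; rewrite ?addr0.
Qed.

Lemma ext_addN alpha : ext_add alpha (ext_opp alpha) = ext_N alpha.
Proof.
have [a [[N0 ND NN _] alphaE]] := ext_decomposition alpha.
apply: external_inj; apply/seteqP; split=> [_ [x + [_ [y + <-] <-]]|x Nx].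
- rewrite alphaE => -[z Nz <-] [t Nt <-].
  by rewrite opprD addrACA subrr add0r; apply: ND => //; exact: NN.
- exists (a + x); first by rewrite alphaE; exists x.
  exists (- a); last by rewrite addrAC subrr add0r.
  by exists a => //; rewrite alphaE; exists 0; rewrite ?addr0.
Qed.

Lemma ext_addNK alpha : ext_add (ext_add alpha (ext_opp alpha)) alpha = alpha.
Proof.
by rewrite ext_addN ext_addC; apply/ext_add_absorb => //; exact: ext_N_neutrix.
Qed.

End ExternalAddition.

Theorem proposition3p1 (R : realType) (S : nonstandard_reals R) (m n : nat) :
  (forall A B C O : 'M[external S]_(m, n), neutricial O ->
     [/\ mx_add A (mx_add B C) = mx_add (mx_add A B) C,
         mx_add A B = mx_add B A,
         mx_add A O = A <-> (forall i j, O i j `<=` mx_N A i j)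
       & mx_add A (mx_opp A) = mx_N A])
  /\ commutative_regular_semigroup (@mx_add R S m n).
Proof.
have addA : associative (@mx_add R S m n).
  by move=> A B C; apply/matrixP => i j; rewrite !mxE ext_addA.
have addC : commutative (@mx_add R S m n).
  by move=> A B; apply/matrixP => i j; rewrite !mxE ext_addC.
split=> [A B C O nO|].
  split=> //; last by apply/matrixP => i j; rewrite !mxE ext_addN.
  split=> [/matrixP AO i j|ON].
    by rewrite mxE; apply/ext_add_absorb => //; rewrite -[RHS]AO mxE.
  apply/matrixP => i j; rewrite mxE; apply/ext_add_absorb => //.
  by have := ON i j; rewrite mxE.
split=> // A; exists (mx_opp A).
by apply/matrixP => i j; rewrite !mxE ext_addNK.
Qed.
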